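(* Let $X_1,\dots,X_n$ be i.i.d. with continuous distribution function $F$ on $[0,\infty)$ having finite mean and a density $f$ with $f(x)>0$ for all $x\ge 0$. Let $a_n=\alpha n^{-1}\log\log n$ with $\alpha>1$, and $b_n=F^{-1}(1-a_n)$. (i) Suppose there exists $h\in\mathcal H(\downarrow)$ such that $$M_1\equiv\sup_{x\ge 0}\frac{\int_x^\infty h(F(t))\,dt\,/\,h(F(x))}{e(x)}<\infty .$$ Then $$\sup\left\{\frac{|\hat e_n(x)-e(x)|\,\overline F(x)}{h(F(x))\,e(x)}:\ 0\le x\le b_n\right\}\to 0\quad\text{almost surely as } n\to\infty.$$ (ii) Suppose there exists $h\in\mathcal H(\downarrow)$ with $\int_0^\infty h(F(t))\,dt<\infty$ and $\sup_{x\ge0} e(x)h(F(x))<\infty$. Then $$\sup\{|\hat e_n(x)-e(x)|\,\overline F(x):\ 0\le x\le b_n\}\to 0\quad\text{almost surely as } n\to\infty.$$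
   Context: $\overline F=1-F$. The mean residual life function is $e(x)=E(X-x\mid X>x)=\int_x^\infty\overline F(t)\,dt/\overline F(x)$ for $x\ge0$. $\mathbb F_n$ is the empirical distribution function of $X_1,\dots,X_n$, $\overline{\mathbb F}_n=1-\mathbb F_n$, $X_{nn}=\max_i X_i$, and the estimator is $\hat e_n(x)=\left\{\int_x^\infty\overline{\mathbb F}_n(t)\,dt/\overline{\mathbb F}_n(x)\right\}1_{[0,X_{nn})}(x)$. $\mathcal H(\downarrow)$ denotes the set of all nonnegative, nonincreasing functions $h$ on $[0,1]$ with $\int_0^1 (1/h(t))\,dt<\infty$. *)

(* Defs.v *)
From HB Require Import structures.
From mathcomp Require Import all_boot all_order all_algebra.
From mathcomp Require Import all_classical all_reals all_analysis.
Set Implicit Arguments. Unset Strict Implicit. Unset Printing Implicit Defensive.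
Import Order.TTheory GRing.Theory Num.Theory.
Import numFieldNormedType.Exports.
Local Open Scope classical_set_scope.
Local Open Scope ring_scope.

Definition mutually_independent d (T : measurableType d) (R : realType)
  (P : probability T R) (X : nat -> T -> R) : Prop :=
  forall (s : seq nat) (B : nat -> set R),
    uniq s -> (forall i, measurable (B i)) ->
    P (\bigcap_(i in [set` s]) (X i @^-1` B i)) =
    (\prod_(i <- s) P (X i @^-1` B i))%E.

Definition has_cdf d (T : measurableType d) (R : realType)
  (P : probability T R) (Y : T -> R) (F : R -> R) : Prop :=
  forall x : R, P (Y @^-1` `]-oo, x]) = (F x)%:E.

Definition mrl (R : realType) (F : R -> R) (x : R) : R :=
  fine (\int[lebesgue_measure]_(t in `[x, +oo[) (1 - F t)%:E)%E / (1 - F x).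

Definition empF (T : Type) (R : realType) (X : nat -> T -> R)
  (n : nat) (w : T) (t : R) : R :=
  (#|[set i : 'I_n | X i w <= t]|)%:R / n%:R.

(** The estimator \hat e_n(x): the empirical mean residual life multiplied
    by the indicator of [0, X_nn), X_nn = max_{i<n} X_i. *)
Definition ehat (T : Type) (R : realType) (X : nat -> T -> R)
  (n : nat) (w : T) (x : R) : R :=
  if (0 <= x) && [exists i : 'I_n, x < X i w] then
    fine (\int[lebesgue_measure]_(t in `[x, +oo[) (1 - empF X n w t)%:E)%E
      / (1 - empF X n w x)
  else 0.

Definition quantile (R : realType) (F : R -> R) (u : R) : R :=
  inf [set x | u <= F x].

Definition H_down (R : realType) (h : R -> R) : Prop :=
  (forall t, 0 <= t <= 1 -> 0 <= h t) /\
  (forall s t, 0 <= s -> s <= t -> t <= 1 -> h t <= h s) /\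
  (\int[lebesgue_measure]_(t in `[0%R, 1%R]) 
      (if h t == 0%R then +oo else ((h t)^-1)%:E) < +oo)%E.

Definition a_seq (R : realType) (alpha : R) (n : nat) : R :=
  alpha * ln (ln n%:R) / n%:R.

Definition b_seq (R : realType) (F : R -> R) (alpha : R) (n : nat) : R :=
  quantile F (1 - a_seq alpha n).

(* Main.v *)
(** Write S = 1 - F and S_n for the empirical survival function. For S_n(x) > 0,
      (e^_n(x) - e(x)) S(x)
        = (S(x) / S_n(x)) (int_x^oo (S_n - S) - e(x) (S_n(x) - S(x))),
    so everything reduces to two almost sure facts about S_n:
    - S / S_n is eventually bounded on {S >= a_n}, by Chernoff's bound along
      geometric blocks of n and a dyadic grid of values of S;
    - sup |S_n - S| / h(F) -> 0, by Glivenko-Cantelli on {F <= 1 - 2^-J}, and by a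
      Chernoff bound at the points where S = 2^-j, j >= J, along n = 2^k. The
      double series of probabilities converges because
      sum_j 2^-j / h(1 - 2^-(j+1)) <= 4 int_0^1 1/h. *)
Require Import Defs.
From HB Require Import structures.
From mathcomp Require Import all_boot all_order all_algebra.
From mathcomp Require Import all_classical all_reals all_analysis.
From mathcomp Require Import measurable_realfun ring lra.
Import Order.TTheory GRing.Theory Num.Theory.
Import numFieldNormedType.Exports.
Local Open Scope classical_set_scope.
Local Open Scope ring_scope.

(** The counts [n * S_n(x)] are monotone in [n] and in [x], so estimates at sparse times and at grid
    points spread to all [n] and [x] at the price of a constant factor. The two facts concern
    different ranges. The deviation must be controlled on all of [[0, oo[], because the integral of
    [S_n - S] runs to infinity. There the integrability of [1/h] acts as a moment condition: at a
    point with [S = p], the expected number of [n = 2^k] for which [S_n] reaches [eps h / 2] is of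
    order [p / (eps h)], with [h] taken at the next dyadic point. Far in the tail no cancellation
    between [S_n] and [S] is used: each is below [eps h] on its own. The range [x <= b_n] and
    [alpha > 1] enter through [S / S_n]: any constant bound will do, and accepting a large one
    brings the Chernoff exponent as close to [n S] as desired, which admits every [alpha > 1]. *)

(** * Counts of exceedances and their Chernoff bounds *)

Section independent_exceedances.
Context {R : realType} {d : measure_display} {T : measurableType d}.
Variables (P : probability T R) (X : nat -> T -> R).
Hypothesis mX : forall i, measurable_fun setT (X i).
Hypothesis indX : mutually_independent P X.

Definition exceedances (n : nat) (x : R) (w : T) : nat :=
  (\sum_(i < n) (x < X i w)%R)%N.

Lemma exceedancesS n x w :
  exceedances n.+1 x w = (exceedances n x w + (x < X n w)%R)%N.
Proof. by rewrite /exceedances big_ord_recr. Qed.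

Lemma leq_exceedances m n x w :
  (m <= n)%N -> (exceedances m x w <= exceedances n x w)%N.
Proof.
move=> mn; rewrite -(subnK mn); elim: (n - m)%N => [|k ih]; first by rewrite add0n.
by rewrite addSn exceedancesS (leq_trans ih)// leq_addr.
Qed.

Lemma exceedances_nonincreasing n x y w :
  x <= y -> (exceedances n y w <= exceedances n x w)%N.
Proof.
move=> xy; apply: leq_sum => i _; case: (ltP y (X i w)) => // yX.
by rewrite (le_lt_trans xy yX).
Qed.

Lemma measurable_preimageX i (A : set R) :
  measurable A -> measurable (X i @^-1` A).
Proof. by move=> mA; rewrite -[_ @^-1` _]setTI; exact: mX. Qed.

Lemma measurable_exceedances n x (D : set nat) :
  measurable (exceedances n x @^-1` D).
Proof.
elim: n D => [|n ih] D.
  have -> : exceedances 0 x @^-1` D = [set _ | D 0%N].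
    by apply/seteqP; split => w /=; rewrite /exceedances big_ord0.
  by case: (pselect (D 0%N)) => D0; [rewrite (_ : [set _ | _] = setT)|
    rewrite (_ : [set _ | _] = set0)]; rewrite //; apply/seteqP; split.
have -> : exceedances n.+1 x @^-1` D =
    (X n @^-1` `]x, +oo[ `&` exceedances n x @^-1` [set k | D k.+1]) `|`
    (X n @^-1` `]-oo, x] `&` exceedances n x @^-1` D).
  apply/seteqP; split => w /=; rewrite exceedancesS !in_itv/= ?andbT.
    case: ltP => xX Dw; [left|right]; split => //.
    - by rewrite addn1 in Dw.
    - by rewrite addn0 in Dw.
  move=> [[-> Dw]|[]]; first by rewrite addn1.
  by rewrite leNgt => /negbTE ->; rewrite addn0.
apply: measurableU; apply: measurableI; [|exact: ih| |exact: ih];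
  exact: measurable_preimageX.
Qed.

(** These product events are the ones to which [mutually_independent] applies directly, and they are
    stable under adjoining a condition on the preceding variable. *)
Definition future_cylinder (n : nat) (C : set T) : Prop :=
  exists s B, [/\ uniq s, {in s, forall i, (n <= i)%N},
    forall i, measurable (B i : set R) &
    C = \bigcap_(i in [set` s]) (X i @^-1` B i)].

Lemma future_cylinderT n : future_cylinder n setT.
Proof. by exists [::], (fun=> setT); split => //; rewrite set_nil bigcap_set0. Qed.

Lemma measurable_future_cylinder n C : future_cylinder n C -> measurable C.
Proof.
move=> [s [B [_ _ mB ->]]]; apply: fin_bigcap_measurable => // i _.
exact: measurable_preimageX.
Qed.

Lemma future_cylinder_step n C (A : set R) :
  measurable A -> future_cylinder n.+1 C ->
  future_cylinder n (X n @^-1` A `&` C) /\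
  P (X n @^-1` A `&` C) = (P (X n @^-1` A) * P C)%E.
Proof.
move=> mA [s [B [us ns mB ->]]].
have nns : n \notin s by apply/negP => /ns; rewrite ltnn.
pose B' i := if i == n then A else B i.
have mB' i : measurable (B' i) by rewrite /B'; case: ifP.
have sB' i : i \in s -> B' i = B i.
  by rewrite /B'; case: eqP => // -> /(negP nns).
have eqC : X n @^-1` A `&` \bigcap_(i in [set` s]) (X i @^-1` B i) =
    \bigcap_(i in [set` n :: s]) (X i @^-1` B' i).
  apply/seteqP; split => [w [Aw Cw] i /= |w Cw /=].
    rewrite inE => /orP[/eqP ->|si]; first by rewrite /B' eqxx.
    by rewrite sB'//; exact: Cw.
  split; first by have := Cw n; rewrite /= mem_head /B' eqxx; exact.
  by move=> i /= si; rewrite -sB'//; apply: Cw => /=; rewrite inE si orbT.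
have us' : uniq (n :: s) by rewrite /= nns.
split.
  rewrite eqC; exists (n :: s), B'; split => // i.
  by rewrite inE => /orP[/eqP ->//|/ns /ltnW].
rewrite eqC indX// (indX _ _ us mB) big_cons {1}/B' eqxx; congr (_ * _)%E.
by rewrite big_seq [RHS]big_seq; apply: eq_bigr => i si; rewrite sB'.
Qed.

(* Keeping a cylinder [C] of later variables in the statement lets the induction
   peel off the last summand without integrating any product. *)
Lemma chernoff_cylinder (x p sigma : R) :
  (forall i, P (X i @^-1` `]x, +oo[) = p%:E) ->
  forall n t C, future_cylinder n C ->
  (P ([set w | (sigma * t <= sigma * (exceedances n x w)%:R)%R] `&` C) <=
   (expR (- (sigma * t)) * (p * expR sigma + (1 - p)) ^+ n)%:E * P C)%E.
Proof.
move=> Pp.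
have p01 : 0 <= p <= 1.
  by rewrite -!lee_fin -(Pp 0%N) measure_ge0 probability_le1//; exact: measurable_preimageX.
have mL n t : measurable [set w | (sigma * t <= sigma * (exceedances n x w)%:R)%R].
  exact: (measurable_exceedances n x [set k | sigma * t <= sigma * k%:R]).
elim=> [|n ih] t C fC.
  have mC := measurable_future_cylinder _ _ fC.
  rewrite expr0 mulr1; have [st|st] := leP (sigma * t) 0.
    apply: (@le_trans _ _ (1 * P C)%E).
      rewrite mul1e; apply: le_measure; rewrite ?inE//; exact: measurableI.
    apply: lee_wpmul2r => //; rewrite lee_fin -expR0 ler_expR; lra.
  rewrite (_ : _ `&` _ = set0) ?measure0 ?mule_ge0 ?lee_fin ?expR_ge0//.
  apply/seteqP; split => w //= -[]; rewrite /exceedances big_ord0 mulr0; lra.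
have [fC1 PC1] := future_cylinder_step _ _ _ (measurable_itv `]x, +oo[) fC.
have [fC2 PC2] := future_cylinder_step _ _ _ (measurable_itv `]-oo, x]) fC.
have mC := measurable_future_cylinder _ _ fC.
set K := (p * expR sigma + (1 - p)) in ih *.
have K0 : 0 <= K by have := expR_ge0 sigma; rewrite /K; nra.
have Pq : P (X n @^-1` `]-oo, x]) = (1 - p)%:E.
  rewrite (_ : X n @^-1` _ = ~` (X n @^-1` `]x, +oo[)).
    by rewrite probability_setC ?Pp//; exact: measurable_preimageX.
  by apply/seteqP; split => w /=; rewrite !in_itv/= andbT leNgt => /negP.
(* If [X n] exceeds [x], the earlier variables have to supply only [t - 1], which costs a factor
   [expR sigma]; otherwise they must supply all of [t]. The weights [p] and [1 - p] of the two cases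
   add up to the factor [K]. *)
apply: (@le_trans _ _ (P ([set w | (sigma * (t - 1) <= sigma * (exceedances n x w)%:R)%R]
    `&` (X n @^-1` `]x, +oo[ `&` C)) +
  P ([set w | (sigma * t <= sigma * (exceedances n x w)%:R)%R]
    `&` (X n @^-1` `]-oo, x] `&` C)))%E).
  have m1 := measurableI _ _ (mL n (t - 1)) (measurable_future_cylinder _ _ fC1).
  have m2 := measurableI _ _ (mL n t) (measurable_future_cylinder _ _ fC2).
  apply: (le_trans _ (measureU2 _ m1 m2)).
  apply: le_measure; rewrite ?inE//; [exact: measurableI|exact: measurableU|].
  move=> w /= [+ Cw]; rewrite exceedancesS !in_itv/= ?andbT natrD.
  case: ltP => xX /= sL; [left|right]; split => //; lra.
apply: le_trans (leeD (ih _ _ fC1) (ih _ _ fC2)) _.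
rewrite PC1 PC2 Pp Pq -(fineK (fin_num_measure P _ mC)) -!EFinM -EFinD lee_fin.
rewrite (_ : - (sigma * (t - 1)) = - (sigma * t) + sigma); last by ring.
rewrite expRD exprS le_eqVlt; apply/orP; left; apply/eqP.
by rewrite {3}/K; ring.
Qed.

(** The factor [sigma] inside the event covers both tails, according to its sign. The binomial
    generating function is replaced by the Poisson one through [1 + u <= expR u] with
    [u = p * (expR sigma - 1)]. *)
Lemma chernoff (x p sigma t : R) n :
  (forall i, P (X i @^-1` `]x, +oo[) = p%:E) ->
  (P [set w | (sigma * t <= sigma * (exceedances n x w)%:R)%R] <=
   (expR (n%:R * p * (expR sigma - 1) - sigma * t))%:E)%E.
Proof.
move=> Pp; have p01 : 0 <= p <= 1.
  by rewrite -!lee_fin -(Pp 0%N) measure_ge0 probability_le1//; exact: measurable_preimageX.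
have := chernoff_cylinder _ _ sigma Pp n t setT (future_cylinderT n).
rewrite setIT probability_setT mule1 => /le_trans; apply; rewrite lee_fin.
rewrite [leRHS]expRD mulrC ler_wpM2r ?expR_ge0// -mulrA expRM_natl.
rewrite lerXn2r ?nnegrE ?expR_ge0//; first by have := expR_ge0 sigma; nra.
apply: le_trans (expR_ge1Dx _); lra.
Qed.

Lemma exceedances_gt0_prob (x p : R) n :
  (forall i, P (X i @^-1` `]x, +oo[) = p%:E) ->
  (P [set w | (0 < exceedances n x w)%N] <= (n%:R * p)%:E)%E.
Proof.
move=> Pp.
have mA (i : nat) : measurable (X i @^-1` `]x, +oo[) by exact: measurable_preimageX.
apply: (@le_trans _ _ (\sum_(i < n) P (X i @^-1` `]x, +oo[))%E).
  apply: (le_trans _ (@Boole_inequality _ _ _ P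
    (fun i => X i @^-1` `]x, +oo[) n (fun i _ => mA i))).
  apply: le_measure; rewrite ?inE.
  - exact: (measurable_exceedances n x [set k | (0 < k)%N]).
  - exact: bigsetU_measurable.
  move=> w /=; rewrite lt0n sum_nat_eq0 negb_forall => /existsP[i].
  rewrite -(bigcup_mkord n (fun i => X i @^-1` `]x, +oo[)) => xX; exists i => //=.
  by rewrite in_itv/= andbT; move: xX; case: ltP.
under eq_bigr do rewrite Pp.
by rewrite sumEFin sumr_const card_ord mulr_natl.
Qed.

End independent_exceedances.

(** * Borel-Cantelli for doubly indexed families *)

Section borel_cantelli_families.
Context {R : realType} {d : measure_display} {T : measurableType d}.
Variable P : probability T R.

(** Borel-Cantelli applied to the unions over [j]. Summability is asked of finite double sums of
    reals, so that applications may exchange and telescope them by plain algebra. *)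
Lemma ae_eventually_none_family (D : nat -> nat -> set T) (u : nat -> nat -> R) (C : R) :
  (forall k j, measurable (D k j)) ->
  (forall k j, (P (D k j) <= (u k j)%:E)%E) ->
  (forall K J, \sum_(k < K) \sum_(j < J) u k j <= C) ->
  {ae P, forall w, \forall k \near \oo, forall j, ~ D k j w}.
Proof.
move=> mD Pu uC; pose E k := \bigcup_j D k j.
have mE k : measurable (E k) by exact: bigcup_measurable.
have u0 k j : 0 <= u k j by rewrite -lee_fin (le_trans _ (Pu k j)).
have PE0 : P (lim_sup_set E) = 0%E.
  apply: lim_sup_set_cvg0 => //; apply: (@le_lt_trans _ _ C%:E); last by rewrite ltry.
  apply: (@le_trans _ _ (\sum_(k <oo) \sum_(j <oo) (u k j)%:E)%E).
    apply: lee_nneseries => // k _.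
    apply: (le_trans (@generalized_Boole_inequality _ _ _ P (D k) (mD k) (mE k))) => //.
    by apply: lee_nneseries => // j _; exact: Pu.
  apply: lime_le.
    by apply: is_cvg_nneseries => k _ _; apply: nneseries_ge0 => j _ _; rewrite lee_fin.
  near=> K; rewrite big_mkord -nneseries_sum//; last by move=> *; rewrite lee_fin.
  apply: lime_le.
    by apply: is_cvg_nneseries => k _ _; apply: sume_ge0 => j _; rewrite lee_fin.
  near=> J; rewrite big_mkord exchange_big/=; under eq_bigr do rewrite sumEFin.
  by rewrite sumEFin lee_fin; exact: uC.
exists (lim_sup_set E); split => //.
  apply: bigcap_measurable => // k _; exact: bigcup_measurable.
move=> w /= nw k _; apply: contrapT => nE; apply: nw.
exists k => // i /= ki j Dw; apply: nE.
by exists i => //; exists j.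
Unshelve. all: by end_near. Qed.

Lemma ae_eventually_none (D : nat -> set T) (u : nat -> R) (C : R) :
  (forall k, measurable (D k)) ->
  (forall k, (P (D k) <= (u k)%:E)%E) ->
  (forall K, \sum_(k < K) u k <= C) ->
  {ae P, forall w, \forall k \near \oo, ~ D k w}.
Proof.
move=> mD Pu uC.
have := @ae_eventually_none_family (fun k j => if j == 0%N then D k else set0)
  (fun k j => if j == 0%N then u k else 0) C.
move=> H; have {}H : {ae P, forall w, \forall k \near \oo, forall j : nat,
    ~ (if j == 0%N then D k else set0) w}.
  apply: H => [k [|j]//=|k [|j]//=|K [|J]].
  - by rewrite measure0.
  - under eq_bigr do rewrite big_ord0.
    by rewrite big1_eq; have := uC 0%N; rewrite big_ord0.
  - under eq_bigr do rewrite big_ord_recl/= big1 ?addr0//.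
    exact: uC.
by apply: filterS H => w; apply: filterS => k /(_ 0%N).
Qed.

End borel_cantelli_families.

(** * Distribution functions with a positive density *)

Section distribution_function.
Context {R : realType} {d : measure_display} {T : measurableType d}.
Variables (P : probability T R) (Y : T -> R) (F f : R -> R).
Hypothesis mY : measurable_fun setT Y.
Hypothesis cdfF : has_cdf P Y F.
Hypothesis contF : continuous F.
Hypothesis mf : measurable_fun setT f.
Hypothesis densF : forall x : R, 0 <= x ->
  (F x)%:E = (\int[lebesgue_measure]_(t in `[0%R, x]) (f t)%:E)%E.
Hypothesis f_gt0 : forall x : R, 0 <= x -> 0 < f x.

Let mYpre (A : set R) : measurable A -> measurable (Y @^-1` A).
Proof. by move=> mA; rewrite -[_ @^-1` _]setTI; exact: mY. Qed.

Lemma has_cdf_nondecreasing (x y : R) : x <= y -> F x <= F y.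
Proof.
move=> xy; rewrite -lee_fin -!cdfF; apply: le_measure; rewrite ?inE; try exact: mYpre.
by apply: preimage_subset; exact: subitvPr.
Qed.

Lemma has_cdf_ge0 (x : R) : 0 <= F x.
Proof. by rewrite -lee_fin -cdfF. Qed.

Lemma has_cdf_le1 (x : R) : F x <= 1.
Proof. by rewrite -lee_fin -cdfF; apply: probability_le1; exact: mYpre. Qed.

Lemma has_cdf_survival (x : R) : P (Y @^-1` `]x, +oo[) = (1 - F x)%:E.
Proof.
rewrite (_ : Y @^-1` _ = ~` (Y @^-1` `]-oo, x])).
  by rewrite probability_setC ?cdfF//; exact: mYpre.
by apply/seteqP; split => w /=; rewrite !in_itv/= andbT ltNge => /negP.
Qed.

Lemma cdf_density_at0 : F 0 = 0.
Proof. by apply: EFin_inj; rewrite densF// set_itv1 integral_set1. Qed.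

(** If [F x = F y], then [f] has integral zero over []x, y]], hence vanishes almost everywhere
    there; positivity of [f] puts the whole interval inside a null set, although its length is
    [y - x]. *)
Lemma cdf_density_increasing (x y : R) : 0 <= x -> x < y -> F x < F y.
Proof.
move=> x0 xy; have y0 : 0 <= y by lra.
rewrite lt_neqAle has_cdf_nondecreasing ?(ltW xy)// andbT; apply/eqP => Fxy.
have mfE (D : set R) : measurable_fun D (fun t => (f t)%:E).
  by apply: measurable_funTS; exact/measurable_EFinP.
have f0 t : 0 <= t -> (0 <= (f t)%:E)%E by move=> /f_gt0/ltW; rewrite lee_fin.
have I0 : (\int[lebesgue_measure]_(t in `]x, y]) (f t)%:E = 0)%E.
  have := densF _ y0; rewrite (_ : `[0, y]%classic = `[0, x]%classic `|` `]x, y]%classic); last first.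
    apply/seteqP; split => t /=; rewrite !in_itv/=.
      by case: (leP t x) => tx /andP[t0 ty]; [left|right]; rewrite ?t0 ?tx ?ty.
    by move=> [|] /andP[? ?]; apply/andP; split; lra.
  rewrite ge0_integral_setU//=.
  - rewrite -densF// -Fxy; case: (\int[lebesgue_measure]_(t in `]x, y]) (f t)%:E)%E => [r|//|//].
    rewrite -EFinD => -[Fr].
    by congr EFin; lra.
  - exact: mfE.
  - by move=> t [] /=; rewrite in_itv/= => /andP[? ?]; apply: f0; lra.
  - by apply/disj_setPRL => t /=; rewrite !in_itv/= => /andP[? ?]; apply/negP; lra.
have /(ae_eq_integral_abs lebesgue_measure (measurable_itv `]x, y]) (mfE _)).1 :
    (\int[lebesgue_measure]_(t in `]x, y]) `|(f t)%:E| = 0)%E.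
  rewrite -I0; apply: eq_integral => t; rewrite inE/= in_itv/= => /andP[xt _].
  by rewrite ger0_norm// ltW// f_gt0//; lra.
move=> [N [mN N0 sub]].
have : (lebesgue_measure (`]x, y]%classic : set R) <= lebesgue_measure N)%E.
  apply: le_measure; rewrite ?inE// => t xt; apply: sub => /= /(_ xt) [ft0].
  move: xt; rewrite /= in_itv/= => /andP[xt _].
  by have := f_gt0 t ltac:(lra); rewrite ft0 ltxx.
by rewrite N0 lebesgue_measure_itv/= lte_fin xy EFinN -EFinD lee_fin; lra.
Qed.

Lemma cdf_density_lt1 (x : R) : 0 <= x -> F x < 1.
Proof.
move=> x0; apply: lt_le_trans (has_cdf_le1 (x + 1)).
apply: cdf_density_increasing => //; lra.
Qed.

Lemma cdf_density_quantile (u : R) : 0 <= u -> u < 1 -> exists2 x, 0 <= x & F x = u.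
Proof.
move=> u0 u1.
have [b b0 Fb] : exists2 b, 0 <= b & u <= F b.
  pose Y' : {RV P >-> R} := mfun_Sub (mem_set mY).
  have FE b : F b = (fine \o cdf Y') b by rewrite /= /cdf /distribution /pushforward/= cdfF.
  have /fine_cvg cF := cvg_cdfy1 Y'.
  near (pinfty_nbhs R) => b; exists b.
    by near: b; exact: nbhs_pinfty_ge.
  by rewrite FE; near: b; exact: cvgr_ge cF _ u1.
have [||c] := @IVT R F 0 b u b0.
- exact: continuous_subspaceT.
- by rewrite cdf_density_at0 min_l ?has_cdf_ge0// max_r ?has_cdf_ge0// u0.
by rewrite in_itv/= => /andP[c0 _]; exists c.
Unshelve. all: by end_near. Qed.

End distribution_function.

(** * The strong law for counts and the Glivenko-Cantelli theorem *)

(** Compare [(1 - s) * expR s <= 1] with [(1 - s) * (1 + s + 2 s^2) = 1 + s^2 * (1 - 2 s)], which is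
    at least 1 for [s <= 1/2]. *)
Lemma expR_le_quadratic (R : realType) (s : R) : - 2^-1 <= s <= 2^-1 ->
  expR s <= 1 + s + 2 * s ^+ 2.
Proof.
move=> s2; have s1 : 0 < 1 - s by lra.
have eN : 1 - s <= (expR s)^-1 by rewrite -expRN; have := expR_ge1Dx (- s); lra.
have e0 := expR_gt0 s.
have {}eN : (1 - s) * expR s <= 1 by rewrite -ler_pdivlMr// div1r.
rewrite -(ler_pM2l s1); apply: le_trans eN _; nra.
Qed.

Lemma sum_geometric_le (R : realType) (q : R) K : 0 <= q -> q < 1 ->
  \sum_(k < K) q ^+ k <= (1 - q)^-1.
Proof.
move=> q0 q1; rewrite -[leRHS]mul1r ler_pdivlMr; last lra.
have -> : (\sum_(k < K) q ^+ k) * (1 - q) = 1 - q ^+ K.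
  by rewrite mulrC -[1 - q ^+ K]opprB subrX1 -mulNr opprB.
by have := exprn_ge0 K q0; lra.
Qed.

Section empirical_tail.
Context {R : realType} {d : measure_display} {T : measurableType d}.
Variables (P : probability T R) (X : nat -> T -> R) (F : R -> R).
Hypothesis mX : forall i, measurable_fun setT (X i).
Hypothesis indX : mutually_independent P X.
Hypothesis survX : forall x i, P (X i @^-1` `]x, +oo[) = (1 - F x)%:E.
Hypothesis F_ge0 : forall x, 0 <= F x.
Hypothesis F_incr : forall x y : R, 0 <= x -> x < y -> F x < F y.
Hypothesis F_lt1 : forall x : R, 0 <= x -> F x < 1.
Hypothesis F_quantile : forall u : R, 0 <= u -> u < 1 -> exists2 x, 0 <= x & F x = u.
Local Notation N := (exceedances X).

Lemma ae_exceedances_cvg (x eps : R) : 0 <= x -> 0 < eps ->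
  {ae P, forall w, \forall n \near \oo, `|(N n x w)%:R - n%:R * (1 - F x)| <= n%:R * eps}.
Proof.
move=> x0 eps0; wlog eps1 : eps eps0 / eps <= 1.
  move=> H; have [/H|/ltW e1] := leP eps 1; first exact.
  have := H 1 ltac:(lra) ltac:(lra); apply: filterS => w; apply: filterS => n.
  by move=> /le_trans; apply; rewrite ler_wpM2l.
set p := 1 - F x; have p01 : 0 <= p <= 1.
  by have := F_ge0 x; have := F_lt1 x x0; rewrite /p; lra.
(* For [sigma = eps / 4] or [- eps / 4] the threshold [p + 4 sigma] is [p + eps] or [p - eps], and
   the exponent is at most [n (2 p sigma^2 - 4 sigma^2) <= - 2 n sigma^2 = - n eps^2 / 8]. The
   reduction to [eps <= 1] keeps [sigma] in the range of the quadratic bound. *)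
pose q := expR (- (eps ^+ 2 / 8)).
have q1 : q < 1 by rewrite /q expR_lt1; have := exprn_gt0 2 eps0; lra.
have tail (sigma : R) n : `|sigma| = eps / 4 ->
    (P [set w | (sigma * (n%:R * (p + 4 * sigma)) <= sigma * (N n x w)%:R)%R] <= (q ^+ n)%:E)%E.
  move=> sE; have s2 : sigma ^+ 2 = (eps / 4) ^+ 2 by rewrite -sE real_normK// num_real.
  apply: le_trans (chernoff P X mX indX x p sigma _ n (survX x)) _.
  rewrite lee_fin -expRM_natl ler_expR.
  rewrite (_ : _ - _ = n%:R * (p * (expR sigma - 1 - sigma) - 4 * sigma ^+ 2)); last by ring.
  apply: ler_wpM2l => //.
  have : expR sigma <= 1 + sigma + 2 * sigma ^+ 2.
    apply: expR_le_quadratic; rewrite -ler_norml sE; lra.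
  rewrite s2; nra.
have mD (sigma : R) n : measurable [set w | sigma * (n%:R * (p + 4 * sigma)) <= sigma * (N n x w)%:R].
  exact: (measurable_exceedances X mX n x
    [set k | sigma * (n%:R * (p + 4 * sigma)) <= sigma * k%:R]).
have sumq K : \sum_(k < K) q ^+ k <= (1 - q)^-1.
  by apply: sum_geometric_le => //; exact: expR_ge0.
have s4 : `|eps / 4| = eps / 4 by rewrite ger0_norm//; lra.
have H1 := ae_eventually_none P _ _ _ (mD (eps / 4)) (fun n => tail _ n s4) sumq.
have H2 := ae_eventually_none P _ _ _ (mD (- (eps / 4)))
  (fun n => tail (- (eps / 4)) n (etrans (normrN _) s4)) sumq.
apply: filterS2 H1 H2 => w; apply: filterS2 => n.
move=> /negP; rewrite -ltNge => h1 /negP; rewrite -ltNge => h2.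
rewrite ler_norml; apply/andP; split.
  suff : n%:R * (p - eps) <= (N n x w)%:R by lra.
  rewrite leNgt; apply/negP => h; move: h2; nra.
suff : (N n x w)%:R <= n%:R * (p + eps) by lra.
rewrite leNgt; apply/negP => h; move: h1; nra.
Qed.

Lemma ae_exceedances_uniform_cvg (eps : R) : 0 < eps ->
  {ae P, forall w, \forall n \near \oo, forall x, 0 <= x ->
    `|(N n x w)%:R - n%:R * (1 - F x)| <= n%:R * eps}.
Proof.
move=> eps0.
pose m := (Num.truncn (2 / eps)).+1.
have m_eps : 1 / m%:R <= eps / 2.
  rewrite ler_pdivrMr//; have := truncnS_gt (2 / eps); rewrite ltr_pdivrMr// -/m; lra.
have qE (i : 'I_m) : exists q, 0 <= q /\ F q = i%:R / m%:R.
  have [||q q0 Fq] := F_quantile (i%:R / m%:R).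
  - by rewrite divr_ge0.
  - by rewrite ltr_pdivrMr// mul1r ltr_nat.
  - by exists q.
have {qE} /choice[q qE] := qE.
have H : {ae P, forall w, forall i : 'I_m, \forall n \near \oo,
    `|(N n (q i) w)%:R - n%:R * (1 - F (q i))| <= n%:R * (eps / 2)}.
  apply: filter_forall => i; apply: ae_exceedances_cvg; [exact: (qE i).1|lra].
apply: filterS H => w /filter_forall; apply: filterS => n dev x x0.
have Fx0 : 0 <= m%:R * F x by rewrite mulr_ge0.
have /andP[ix xi] := truncn_itv Fx0; set i := Num.truncn _ in ix xi.
have im : (i < m)%N.
  rewrite -(ltr_nat R); apply: le_lt_trans ix _.
  by rewrite -[ltRHS]mulr1 ltr_pM2l// F_lt1.
have {}ix : i%:R / m%:R <= F x by rewrite ler_pdivrMr// mulrC.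
have {}xi : F x < i.+1%:R / m%:R by rewrite ltr_pdivlMr// mulrC.
have qx : q (Ordinal im) <= x.
  rewrite leNgt; apply/negP => /(F_incr _ _ x0); rewrite (qE _).2/=; lra.
have Nxq := exceedances_nonincreasing X n _ _ w qx.
rewrite -(ler_nat R) in Nxq.
have := dev (Ordinal im); rewrite (qE _).2/= ler_norml => /andP[_ devi].
have iS : i.+1%:R / m%:R = i%:R / m%:R + 1 / m%:R :> R by rewrite -natr1 mulrDl.
have n0 : 0 <= n%:R :> R by [].
rewrite ler_norml; apply/andP; split; last nra.
(* The last cell has no right grid point, since [F] stays below 1; there [1 - F x] is at most
   [1 / m], so the lower bound follows from the count being nonnegative. *)
have [iSm|] := ltnP i.+1 m; last first.
  move=> mi; have mE : i.+1 = m by apply/eqP; rewrite eqn_leq mi im.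
  rewrite mE divff ?pnatr_eq0// in xi iS.
  have N0 : 0 <= (N n x w)%:R :> R by [].
  nra.
have xq : x <= q (Ordinal iSm).
  by rewrite leNgt; apply/negP => /(F_incr _ _ (qE _).1); rewrite (qE _).2/=; lra.
have := exceedances_nonincreasing X n _ _ w xq; rewrite -(ler_nat R) => Nqx.
have := dev (Ordinal iSm); rewrite (qE _).2/= ler_norml => /andP[devS _].
nra.
Qed.

End empirical_tail.

(** * Integrability of [1/h] at the dyadic points *)

Lemma nondecreasing_itv_emeasurable (R : realType) (D : interval R) (g : R -> \bar R) :
  {in D &, {homo g : x y / x <= y >-> (x <= y)%E}} -> measurable_fun [set` D] g.
Proof.
move=> g_nd mD; apply: (measurability _ (ErealGenCInfty.measurableE R)) => //.
move=> _ [_ [r ->] <-]; apply: is_interval_measurable => x y /= [Dx gx] [Dy gy] z /andP[xz zy].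
have Dz : z \in D by apply: interval_is_interval Dx Dy _ _; rewrite xz zy.
split=> //; move: gx; rewrite !in_itv/= !andbT => /le_trans; apply; exact: g_nd.
Qed.

Section integrable_inverse_weight.
Context {R : realType} (h : R -> R).
Hypothesis hH : H_down h.

Let G (t : R) : \bar R := if h t == 0 then +oo%E else ((h t)^-1)%:E.
Let v (j : nat) : R := 1 - 2^-1 ^+ j.+1.

Let half_gt0 j : 0 < 2^-1 ^+ j :> R.
Proof. by rewrite exprn_gt0// invr_gt0. Qed.

Let halfS j : 2^-1 ^+ j.+1 = 2^-1 ^+ j / 2 :> R.
Proof. by rewrite exprSr. Qed.

Let v01 j : 0 <= v j /\ v j < 1.
Proof.
have : 2^-1 ^+ j.+1 <= 1 :> R by rewrite exprn_ile1// ?invr_ge0// invf_le1// ler1n.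
by have := half_gt0 j.+1; rewrite /v; lra.
Qed.

Let vS j : v j.+1 = v j + 2^-1 ^+ j.+2.
Proof. by rewrite /v halfS; have := half_gt0 j; lra. Qed.

Let h_ge0 t : 0 <= t <= 1 -> 0 <= h t. Proof. exact: hH.1. Qed.

Let G_ge0 t : 0 <= t <= 1 -> (0 <= G t)%E.
Proof. by move=> t01; rewrite /G; case: ifP => // _; rewrite lee_fin invr_ge0 h_ge0. Qed.

Let G_nd : {in `[0, 1] &, {homo G : x y / x <= y >-> (x <= y)%E}}.
Proof.
move=> x y; rewrite !in_itv/= => x01 y01 xy; rewrite /G.
case: (eqVneq (h y) 0) => hy0; first by rewrite leey.
have hy : 0 < h y by rewrite lt_neqAle eq_sym hy0 h_ge0.
have hx : h y <= h x by apply: hH.2.1; lra.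
by rewrite gt_eqF; [rewrite lee_fin lef_pV2// posrE; lra|lra].
Qed.

Let mG : measurable_fun (`[0, 1]%classic : set R) G.
Proof. exact: nondecreasing_itv_emeasurable. Qed.

(** A lower Riemann sum: [G] is nondecreasing and [[v j, v j.+1[] has length [2^-(j+2)]. The values
    remain extended reals because [h] is not yet known to be positive at the points [v j]. *)
Let int_G_ge J : (\sum_(j < J) ((2^-1 ^+ j.+2)%:E * G (v j)) <=
  \int[lebesgue_measure]_(t in `[0%R, v J[) G t)%E.
Proof.
elim: J => [|J ih].
  rewrite big_ord0; apply: integral_ge0 => t /=; rewrite in_itv/= => /andP[t0 tv].
  by apply: G_ge0; have := v01 0; lra.
have [v0 v1] := v01 J; have [v0' v1'] := v01 J.+1.
have vv : v J < v J.+1 by rewrite vS; have := half_gt0 J.+2; lra.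
have -> : `[0, v J.+1[%classic = `[0, v J[%classic `|` `[v J, v J.+1[%classic.
  apply/seteqP; split => t /=; rewrite !in_itv/=.
    by case: (ltP t (v J)) => tx /andP[t0 ty]; [left|right]; rewrite ?t0 ?tx ?ty.
  by move=> [|] /andP[? ?]; apply/andP; split; lra.
have mGs (a b : R) : 0 <= a -> b <= 1 -> measurable_fun (`[a, b[%classic : set R) G.
  move=> a0 b1; apply: measurable_funS mG => // t /=; rewrite !in_itv/= => /andP[? ?].
  by apply/andP; split; lra.
rewrite ge0_integral_setU//=; last 3 first.
- apply: measurable_funS mG => // t /=; rewrite !in_itv/=.
  by move=> [|] /andP[? ?]; apply/andP; split; lra.
- by move=> t; rewrite !in_itv/= => -[|] /andP[? ?]; apply: G_ge0; lra.
- by apply/disj_setPRL => t /=; rewrite !in_itv/= => /andP[? ?]; apply/negP; lra.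
rewrite big_ord_recr/= leeD//.
have Gv0 : (0 <= G (v J))%E by apply: G_ge0; lra.
rewrite muleC (_ : (2^-1 ^+ J.+2)%:E = lebesgue_measure (`[v J, v J.+1[%classic : set R)); last first.
  by rewrite lebesgue_measure_itv/= lte_fin vv -EFinD vS; congr EFin; lra.
rewrite -integral_cst//; apply: ge0_le_integral => //.
- by apply: mGs; lra.
- move=> t /=; rewrite in_itv/= => /andP[? ?]; apply: G_nd; rewrite ?in_itv/=; lra.
Qed.

Let int_G_le J : (\sum_(j < J) ((2^-1 ^+ j.+2)%:E * G (v j)) <=
  \int[lebesgue_measure]_(t in `[0%R, 1%R]) G t)%E.
Proof.
apply: le_trans (int_G_ge J) _; have [v0 v1] := v01 J.
apply: ge0_subset_integral => //.
by move=> t /=; rewrite !in_itv/= => /andP[? ?]; apply/andP; split; lra.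
Qed.

(** A zero of [h] at [v j] would put an infinite term into the lower Riemann sum, against the
    finiteness of the integral. *)
Lemma H_down_dyadic_gt0 j : 0 < h (1 - 2^-1 ^+ j.+1).
Proof.
have [v0 v1] := v01 j; rewrite -/(v j) lt_neqAle h_ge0 ?andbT; last lra.
apply/eqP => hv; have := int_G_le j.+1; rewrite big_ord_recr/= {2}/G -hv eqxx.
rewrite gt0_muley ?lte_fin// addeC addye; last first.
  rewrite gt_eqF// (lt_le_trans (ltNy0))//; apply: sume_ge0 => i _.
  by rewrite mule_ge0 ?lee_fin ?(ltW (half_gt0 _))// G_ge0//; have := v01 i; lra.
by rewrite leNgt hH.2.2.
Qed.

Lemma H_down_dyadic_sum : exists C : R, forall J,
  \sum_(j < J) 2^-1 ^+ j / h (1 - 2^-1 ^+ j.+1) <= C.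
Proof.
have I0 : (0 <= \int[lebesgue_measure]_(t in `[0%R, 1%R]) G t)%E.
  by apply: integral_ge0 => t /=; rewrite in_itv/=; exact: G_ge0.
have Ifin : (\int[lebesgue_measure]_(t in `[0%R, 1%R]) G t)%E \is a fin_num.
  by rewrite ge0_fin_numE// hH.2.2.
exists (4 * fine (\int[lebesgue_measure]_(t in `[0%R, 1%R]) G t)%E) => J.
rewrite mulrC -ler_pdivrMr// -lee_fin fineK//; apply: le_trans (int_G_le J).
rewrite mulr_suml -sumEFin; apply: lee_sum => j _.
rewrite /G /v gt_eqF ?H_down_dyadic_gt0// -EFinM lee_fin !halfS; lra.
Qed.

End integrable_inverse_weight.

(** * Glivenko-Cantelli with weight [h] *)

Section weighted_glivenko_cantelli.
Context {R : realType} {d : measure_display} {T : measurableType d}.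
Variables (P : probability T R) (X : nat -> T -> R) (F : R -> R).
Hypothesis mX : forall i, measurable_fun setT (X i).
Hypothesis indX : mutually_independent P X.
Hypothesis survX : forall x i, P (X i @^-1` `]x, +oo[) = (1 - F x)%:E.
Hypothesis F_ge0 : forall x, 0 <= F x.
Hypothesis F_incr : forall x y : R, 0 <= x -> x < y -> F x < F y.
Hypothesis F_lt1 : forall x : R, 0 <= x -> F x < 1.
Hypothesis F_quantile : forall u : R, 0 <= u -> u < 1 -> exists2 x, 0 <= x & F x = u.
Local Notation N := (exceedances X).

(* The bound is, up to the factor [6 e p], the increment over [[n, 2n]] of
   [s |-> A s / (s + A)], which is at least [min n (A^2 / n) / 6]; along
   [n = 2^k] these increments telescope to at most [A]. *)
Lemma exceedances_upper_tail (x A : R) n : (0 < n)%N -> 0 < A -> 0 < 1 - F x ->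
  (1 - F x) * A <= expR (- 2) ->
  (P [set w | (n%:R / A <= (N n x w)%:R)%R] <=
    (6 * expR 1 * (1 - F x) * (A * (2 * n%:R) / (2 * n%:R + A) - A * n%:R / (n%:R + A)))%:E)%E.
Proof.
set p := 1 - F x; set s : R := n%:R => n0 A0 p0 pA.
have s0 : 0 < s by rewrite ltr0n.
have e1 : 1 <= expR 1 :> R by rewrite -expR0 ler_expR.
set D := A * (2 * s) / _ - _.
have DE : D = s * A ^+ 2 / ((2 * s + A) * (s + A)).
  by rewrite /D; field; rewrite !gt_eqF//; lra.
have den0 : 0 < (2 * s + A) * (s + A) by apply: mulr_gt0; lra.
have p_eD : p <= expR 1 * p by rewrite ler_peMl// ltW.
(* For [s <= A] the threshold [s / A] is at most 1 and an exponential bound is too weak; the event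
   forces at least one exceedance, and the union bound gives [s * p]. *)
have [sA|As] := leP s A.
  have sD : s <= 6 * D.
    rewrite DE mulrA ler_pdivlMr// [leRHS]mulrCA ler_wpM2l//.
    nra.
  apply: (@le_trans _ _ (s * p)%:E).
    apply: le_trans (exceedances_gt0_prob P X mX x p n (survX x)).
    apply: le_measure; rewrite ?inE.
    - exact: (measurable_exceedances X mX n x [set k | s / A <= k%:R]).
    - exact: (measurable_exceedances X mX n x [set k | (0 < k)%N]).
    - by move=> w /= /(lt_le_trans (divr_gt0 s0 A0)); rewrite ltr0n.
  by rewrite lee_fin; have := ltW s0; nra.
have AD : A ^+ 2 / s <= 6 * D.
  rewrite DE ler_pdivrMr// mulrA mulrAC ler_pdivlMr//.
  rewrite [leRHS](_ : _ = A ^+ 2 * (6 * s ^+ 2)); last by ring.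
  by rewrite ler_wpM2l ?exprn_ge0 ?(ltW A0)//; nra.
set t := s / A; have t1 : 1 <= t by rewrite ler_pdivlMr// mul1r ltW.
have pA0 : 0 < p * A by exact: mulr_gt0.
(* The slope minimising the Chernoff exponent: [expR sigma = (p * A)^-1] solves
   [s * p * expR sigma = t]. *)
set sigma := - ln (p * A).
have sigma2 : 2 <= sigma.
  by rewrite /sigma lerNr -(expRK (- 2)) ler_ln// posrE expR_gt0.
have eS : expR sigma = (p * A)^-1 by rewrite /sigma expRN lnK.
apply: (@le_trans _ _ (expR (t * (1 - sigma)))%:E).
  apply: le_trans (_ : (P [set w | (sigma * t <= sigma * (N n x w)%:R)%R] <= _)%E).
    apply: le_measure; rewrite ?inE.
    - exact: (measurable_exceedances X mX n x [set k | t <= k%:R]).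
    - exact: (measurable_exceedances X mX n x [set k | sigma * t <= sigma * k%:R]).
    - by move=> w /= tN; rewrite ler_wpM2l//; lra.
  apply: le_trans (chernoff P X mX indX x p sigma t n (survX x)) _.
  rewrite lee_fin ler_expR eS -/s.
  have -> : s * p * ((p * A)^-1 - 1) = t - s * p.
    by rewrite /t; field; rewrite !gt_eqF.
  by have := mulr_gt0 s0 p0; nra.
(* Exponential decay in [t] is traded for [1 / t]: since [sigma >= 2], [expR ((t - 1) * (sigma - 1))
   >= 1 + (t - 1) * (sigma - 1) >= t]. The result [expR 1 * p * A^2 / s] is what the increment [D]
   dominates. *)
rewrite lee_fin; apply: (@le_trans _ _ (expR (1 - sigma) * t^-1)).
  rewrite (_ : t * (1 - sigma) = (1 - sigma) + (t - 1) * (1 - sigma)); last by ring.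
  rewrite expRD ler_wpM2l ?expR_ge0//.
  rewrite -[leLHS]invrK -expRN lef_pV2 ?posrE ?expR_gt0//; last lra.
  by apply: le_trans (expR_ge1Dx _); nra.
rewrite expRD expRN eS invrK /t invf_div.
rewrite (_ : expR 1 * (p * A) * (A / s) = expR 1 * p * (A ^+ 2 / s)); last by ring.
rewrite (_ : 6 * expR 1 * p * D = expR 1 * p * (6 * D)); last by ring.
by rewrite ler_wpM2l// mulr_ge0 ?expR_ge0// ltW.
Qed.

Lemma bounded_sums_cvg0 (u : nat -> R) (C : R) : (forall k, 0 <= u k) ->
  (forall K, \sum_(k < K) u k <= C) -> u @ \oo --> 0.
Proof.
move=> u0 uC; apply: cvg_series_cvg_0; apply: nondecreasing_is_cvgn.
  by apply/nondecreasing_seqP => n; rewrite /series/= big_nat_recr//= lerDl.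
by exists C => _ [K _ <-]; rewrite /series/= big_mkord.
Qed.

Variable h : R -> R.
Hypothesis hH : H_down h.
Let p (j : nat) : R := 2^-1 ^+ j.
(** The weight is read one dyadic level beyond [p j]: as [h] is nonincreasing, [H j] bounds
    [h (F x)] from below on the whole cell [1 - p j <= F x <= 1 - p j.+1]. *)
Let H (j : nat) : R := h (1 - 2^-1 ^+ j.+1).
Let H0 j : 0 < H j. Proof. exact: H_down_dyadic_gt0. Qed.
Let p0 j : 0 < p j. Proof. by rewrite exprn_gt0// invr_gt0. Qed.

Lemma ae_exceedances_dyadic_tail (eps : R) (y : nat -> R) : 0 < eps ->
  (forall j, 0 <= y j) -> (forall j, F (y j) = 1 - p j) ->
  {ae P, forall w, exists J, \forall n \near \oo, forall j, (J <= j)%N ->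
    p j <= eps * H j /\ (N n (y j) w)%:R <= n%:R * (eps * H j)}.
Proof.
move=> eps0 y0 Fy.
have pE j : 1 - F (y j) = p j by rewrite Fy; ring.
have [C sumC] := H_down_dyadic_sum h hH.
(* With the 2, the threshold [2^k / A j] is half of [2^k * eps * H j]; the other half pays for
   replacing [n] by a power [2^k <= 2 n] above it. *)
pose A j := 2 / (eps * H j).
have A0 j : 0 < A j by rewrite divr_gt0// mulr_gt0.
have pA0 j : 0 <= p j * A j by rewrite mulr_ge0// ltW.
have sumA J : \sum_(j < J) p j * A j <= 2 / eps * C.
  rewrite (eq_bigr (fun j : 'I_J => 2 / eps * (p j / H j))); last first.
    by move=> j _; rewrite /A; field; rewrite !gt_eqF.
  by rewrite -mulr_sumr ler_wpM2l ?divr_ge0 ?(ltW eps0)//; exact: sumC.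
(* The terms of a bounded series tend to 0. From this [J] on the smallness condition of
   [exceedances_upper_tail] holds, hence the shift [J + j] below. *)
have [J _ HJ] : \forall j \near \oo, p j * A j < expR (- 2).
  by apply: cvgr_lt (bounded_sums_cvg0 _ _ pA0 sumA) _ (expR_gt0 _).
have {}HJ j : (J <= j)%N -> p j * A j <= expR (- 2) by move=> /HJ/ltW.
pose D k j := [set w | (2 ^ k)%N%:R / A (J + j)%N <= (N (2 ^ k) (y (J + j)%N) w)%:R].
pose U j (s : R) := A j * s / (s + A j).
pose u k j := 6 * expR 1 * p (J + j)%N *
  (U (J + j)%N (2 ^ k.+1)%N%:R - U (J + j)%N (2 ^ k)%N%:R).
have U01 j s : 0 < s -> 0 <= U j s <= A j.
  rewrite /U; move: (A j) (A0 j) => a a0 s0.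
  rewrite divr_ge0 ?mulr_ge0 ?(ltW a0) ?(ltW s0)//=; last lra.
  by rewrite ler_pdivrMr; [nra|lra].
have mD k j : measurable (D k j).
  exact: (measurable_exceedances X mX (2 ^ k) _ [set i | (2 ^ k)%N%:R / A (J + j)%N <= i%:R]).
have PD k j : (P (D k j) <= (u k j)%:E)%E.
  rewrite /u -pE /U expnS natrM; apply: exceedances_upper_tail => //.
  - by rewrite expn_gt0.
  - by rewrite pE.
  - by rewrite pE HJ// leq_addr.
have e6 : 0 <= 6 * expR 1 :> R by rewrite mulr_ge0// expR_ge0.
have sumu K L : \sum_(k < K) \sum_(j < L) u k j <= 6 * expR 1 * (2 / eps * C).
  rewrite exchange_big/=; apply: (@le_trans _ _ (6 * expR 1 * \sum_(j < L) p (J + j)%N * A (J + j)%N)).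
    rewrite mulr_sumr; apply: ler_sum => j _; rewrite -mulr_sumr -mulrA ler_wpM2l//.
    rewrite ler_wpM2l ?(ltW (p0 _))//.
    rewrite -(big_mkord xpredT (fun k => U (J + j)%N (2 ^ k.+1)%N%:R - U (J + j)%N (2 ^ k)%N%:R)).
    rewrite telescope_sumr//.
    have /andP[_ U1] := U01 (J + j)%N (2 ^ K)%N%:R ltac:(by rewrite ltr0n expn_gt0).
    by have /andP[U2 _] := U01 (J + j)%N (2 ^ 0)%N%:R ltac:(by rewrite ltr0n expn_gt0); lra.
  rewrite ler_wpM2l//.
  apply: le_trans (sumA (J + L)%N); rewrite big_split_ord/= lerDr.
  by apply: sumr_ge0 => j _.
have := ae_eventually_none_family P D u _ mD PD sumu.
apply: filterS => w [K _ HK]; exists J; exists (2 ^ K)%N => // n /= Kn j Jj; split.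
  have := HJ j Jj; have : expR (- 2) <= 1 :> R by rewrite expR_le1; lra.
  move=> e1 /le_trans/(_ e1); rewrite /A mulrA ler_pdivrMr ?mulr_gt0// mul1r.
  by have := p0 j; lra.
have n0 : (0 < n)%N by apply: leq_trans Kn; rewrite expn_gt0.
pose k := (trunc_log 2 n).+1.
have nk : (n <= 2 ^ k)%N by apply/ltnW/trunc_log_ltn.
have kn : (2 ^ k <= 2 * n)%N by rewrite expnS leq_mul2l/= trunc_logP.
have Kk : (K <= k)%N by apply/leqW; rewrite -(trunc_expnK K (ltnSn 1)) leq_trunc_log.
have := HK k Kk (j - J)%N; rewrite /D subnKC//= => /negP; rewrite -ltNge => NA.
apply: (@le_trans _ _ ((2 ^ k)%N%:R / A j)).
  by apply: le_trans (ltW NA); rewrite ler_nat leq_exceedances.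
rewrite /A invf_div [leLHS]mulrA ler_pdivrMr// [leRHS]mulrAC ler_wpM2r//.
  by rewrite mulr_ge0 ?(ltW eps0) ?(ltW (H0 j)).
by rewrite -natrM ler_nat mulnC.
Qed.

Lemma ae_weighted_glivenko_cantelli :
  {ae P, forall w, forall eps, 0 < eps -> \forall n \near \oo, forall x, 0 <= x ->
    `|(N n x w)%:R - n%:R * (1 - F x)| <= n%:R * (eps * h (F x))}.
Proof.
have yE j : exists y, 0 <= y /\ F y = 1 - p j.
  have p1 : p j <= 1 by rewrite exprn_ile1// ?invr_ge0// invf_le1// ler1n.
  have [||y ? ?] := F_quantile (1 - p j); [lra| by have := p0 j; lra|by exists y].
have {yE} /choice[y yE] := yE.
have h_ni s t : 0 <= s -> s <= t -> t <= 1 -> h t <= h s by exact: hH.2.1.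
have main (eps : R) : 0 < eps -> {ae P, forall w, \forall n \near \oo, forall x, 0 <= x ->
    `|(N n x w)%:R - n%:R * (1 - F x)| <= n%:R * (eps * h (F x))}.
  move=> eps0.
  have tail := ae_exceedances_dyadic_tail eps y eps0 (fun j => (yE j).1) (fun j => (yE j).2).
  have bulk : {ae P, forall w, forall j, \forall n \near \oo, forall x : R, 0 <= x ->
    `|(N n x w)%:R - n%:R * (1 - F x)| <= n%:R * (eps * H j)}.
    apply: ae_foralln => j; apply: ae_exceedances_uniform_cvg => //.
    exact: mulr_gt0.
  apply: filterS2 tail bulk => w [J tailJ] /(_ J); apply: filterS2 tailJ => n tailn bulkn x x0.
  have Fx1 := F_lt1 x x0.
  have exj : exists j, F x <= 1 - p j.+1.
    have [j _ Hj] : \forall j \near \oo, p j < 1 - F x.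
      apply: cvgr_lt (_ : 0 < _); last by lra.
      by apply: cvg_expr; rewrite ger0_norm ?invr_ge0// invf_lt1// ltr1n.
    by exists j; have := Hj j.+1 (leqnSn j); lra.
  have [j Fxj jmin] := ex_minnP exj.
  have Hjx : H j <= h (F x).
    by apply: h_ni => //; have := p0 j.+1; rewrite -/(p _); lra.
  (* In the cells before [J], [h (F x) >= H J], so the unweighted theorem with precision [eps * H J]
     suffices. Beyond, [S_n] and [S] are nonnegative and each at most [eps * h (F x)], hence so is
     their distance. *)
  have [jJ|Jj] := ltnP j J.
    apply: le_trans (bulkn x x0) _; rewrite ler_wpM2l// ler_wpM2l ?(ltW eps0)//.
    apply: le_trans Hjx; apply: h_ni; rewrite -/(p _) -/(p _).
    - have : p j.+1 <= 1 by rewrite exprn_ile1// ?invr_ge0// invf_le1// ler1n.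
      lra.
    - suff : p J.+1 <= p j.+1 by lra.
      by rewrite ler_wiXn2l ?invr_ge0// ?invf_le1// ?ler1n// ltnS ltnW.
    - by have := p0 J.+1; lra.
  have [pj Nj] := tailn j Jj.
  have [yx Fjx] : y j <= x /\ 1 - p j <= F x.
    case: j jmin {Fxj Hjx pj Nj Jj} => [|j] jmin.
      split; last by rewrite /p expr0 subrr.
      rewrite leNgt; apply/negP => /(F_incr _ _ x0).
      by rewrite (yE _).2 /p expr0 subrr ltNge F_ge0.
    have : ~~ (F x <= 1 - p j.+1) by apply/negP => /jmin; rewrite ltnn.
    rewrite -ltNge => pFx; split; last exact: ltW.
    by rewrite leNgt; apply/negP => /(F_incr _ _ x0); rewrite (yE _).2; lra.
  have := exceedances_nonincreasing X n _ _ w yx; rewrite -(ler_nat R) => NN.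
  have n0 : 0 <= n%:R :> R by [].
  have epsH : n%:R * (eps * H j) <= n%:R * (eps * h (F x)).
    by rewrite ler_wpM2l// ler_wpM2l// ltW.
  have nS : n%:R * (1 - F x) <= n%:R * (eps * H j) by rewrite ler_wpM2l//; lra.
  have nS0 : 0 <= n%:R * (1 - F x) by rewrite mulr_ge0//; lra.
  have N0 : 0 <= (N n x w)%:R :> R by [].
  by rewrite ler_norml; apply/andP; split; lra.
(* The precisions [1 / (m + 1)] form a countable family, so a single null set serves all [eps]. *)
have H1 : {ae P, forall w, forall m, \forall n \near \oo, forall x, 0 <= x ->
    `|(N n x w)%:R - n%:R * (1 - F x)| <= n%:R * (m.+1%:R^-1 * h (F x))}.
  by apply: ae_foralln => m; apply: main; rewrite invr_gt0.
apply: filterS H1 => w Hw eps eps0.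
have := Hw (Num.truncn eps^-1); apply: filterS => n Hn x x0.
apply: le_trans (Hn x x0) _; rewrite ler_wpM2l// ler_wpM2r//.
  by apply: hH.1; rewrite F_ge0 ltW// F_lt1.
by rewrite invf_ple ?posrE// ltW// truncnS_gt.
Qed.

End weighted_glivenko_cantelli.

(** * The empirical survival function bounded below by the true one *)

(** An integral test for [(k + 2)^-g] in telescoping form: with [phi k = (k + 1)^(1 - g)], the
    inequality [ln (k + 2) - ln (k + 1) >= 1 / (k + 2)] gives [(g - 1) (k + 2)^-g <= phi k - phi (k
    + 1)]. *)
Lemma sum_expR_ln_le (R : realType) (g : R) K : 1 < g ->
  \sum_(k < K) expR (- (g * ln k.+2%:R)) <= (g - 1)^-1.
Proof.
move=> g1; pose phi (k : nat) : R := expR (- ((g - 1) * ln k.+1%:R)).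
have step k : (g - 1) * expR (- (g * ln k.+2%:R)) <= - (phi k.+1 - phi k).
  have k1 : 0 < k.+1%:R :> R by [].
  have k2 : 0 < k.+2%:R :> R by [].
  have lnS : k.+2%:R^-1 <= ln k.+2%:R - ln k.+1%:R :> R.
    have : ln (1 + - k.+2%:R^-1) <= - k.+2%:R^-1 :> R.
      by apply: le_ln1Dx; rewrite ltrN2 invf_lt1// ltr1n.
    have -> : 1 + - k.+2%:R^-1 = k.+1%:R / k.+2%:R :> R.
      by rewrite -[k.+2%:R]natr1; field; rewrite gt_eqF.
    by rewrite ln_div ?posrE// => lnk; rewrite -lerN2 opprB.
  have -> : phi k = phi k.+1 * expR ((g - 1) * (ln k.+2%:R - ln k.+1%:R)).
    by rewrite /phi -expRD; congr expR; ring.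
  have -> : expR (- (g * ln k.+2%:R)) = phi k.+1 * k.+2%:R^-1.
    rewrite /phi -{3}(lnK (x := k.+2%:R)) ?posrE// -expRN -expRD.
    by congr expR; ring.
  rewrite opprB -[X in _ <= _ - X]mulr1 -mulrBr mulrCA ler_wpM2l ?expR_ge0//.
  rewrite lerBrDl; apply: le_trans (expR_ge1Dx _).
  by rewrite lerD2l ler_wpM2l//; lra.
have g10 : 0 < g - 1 by lra.
rewrite -[leRHS]mulr1 ler_pdivlMl// mulr_sumr.
apply: (@le_trans _ _ (\sum_(k < K) - (phi k.+1 - phi k))).
  by apply: ler_sum => k _; exact: step.
rewrite sumrN -(big_mkord xpredT (fun k => phi k.+1 - phi k)) telescope_sumr//.
have -> : phi 0 = 1 by rewrite /phi ln1 mulr0 oppr0 expR0.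
have phiK : 0 <= phi K by exact: expR_ge0.
lra.
Qed.

Section survival_ratio.
Context {R : realType} {d : measure_display} {T : measurableType d}.
Variables (P : probability T R) (X : nat -> T -> R) (F : R -> R).
Hypothesis mX : forall i, measurable_fun setT (X i).
Hypothesis indX : mutually_independent P X.
Hypothesis survX : forall x i, P (X i @^-1` `]x, +oo[) = (1 - F x)%:E.
Hypothesis F_ge0 : forall x, 0 <= F x.
Hypothesis F_nd : forall x y : R, x <= y -> F x <= F y.
Hypothesis F_quantile : forall u : R, 0 <= u -> u < 1 -> exists2 x, 0 <= x & F x = u.
Local Notation N := (exceedances X).

(** Chernoff with slope [- s]. A large [s] with a small product [s * c] brings [beta] as close to 1
    as desired. *)
Lemma exceedances_lower_tail (x s c beta : R) n :
  0 <= s -> beta = 1 - expR (- s) - s * c ->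
  (P [set w | ((N n x w)%:R <= c * (n%:R * (1 - F x)))%R] <=
    (expR (- (beta * (n%:R * (1 - F x)))))%:E)%E.
Proof.
move=> s0 ->; set t := c * _.
apply: (@le_trans _ _ (P [set w | (- s * t <= - s * (N n x w)%:R)%R])).
  apply: le_measure; rewrite ?inE.
  - exact: (measurable_exceedances X mX n x [set k | k%:R <= t]).
  - exact: (measurable_exceedances X mX n x [set k | - s * t <= - s * k%:R]).
  - by move=> w /= Nt; rewrite !mulNr lerN2 ler_wpM2l.
apply: le_trans (chernoff P X mX indX x _ (- s) t n (survX x)) _.
by rewrite lee_fin ler_expR /t; lra.
Qed.

(* Blocks [r^k < n <= r^(k+1)] with ratio [r < alpha], so that the Chernoff bound
   at the start of the block still beats [k^-1], and a grid of tail probabilities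
   [2^j p k] within each block. *)
Lemma ae_survival_ratio (alpha : R) : 1 < alpha -> exists2 c : R, 0 < c &
  {ae P, forall w, \forall n \near \oo, forall x, a_seq alpha n <= 1 - F x ->
    c * (n%:R * (1 - F x)) <= (N n x w)%:R}.
Proof.
move=> alpha1.
pose r := (1 + alpha) / 2; have r1 : 1 < r by rewrite /r; lra.
have r0 : 0 < r by lra.
pose l := ln r; have l0 : 0 < l by exact: ln_gt0.
pose kappa := alpha / r.
have kappa1 : 1 < kappa by rewrite /kappa ltr_pdivlMr// mul1r /r; lra.
(* Below, [expR (- s)] and [s * c] are both made equal to [del / 3]; then [beta = 1 - 2 del / 3] and
   [g = kappa * beta = (kappa + 2) / 3], which exceeds 1. *)
pose del := 1 - kappa^-1.
have kV : 0 < kappa^-1 < 1 by rewrite invr_gt0 invf_lt1; lra.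
have del01 : 0 < del < 1 by rewrite /del; lra.
pose s := - ln (del / 3).
have s0 : 0 < s by rewrite /s oppr_gt0 ln_lt0//; lra.
pose c := del / 3 / s.
have c0 : 0 < c by rewrite /c !divr_gt0//; lra.
pose beta := 1 - expR (- s) - s * c.
have betaE : beta = 1 - 2 * del / 3.
  rewrite /beta {1}/s opprK lnK ?posrE; last lra.
  by rewrite /c; field; rewrite gt_eqF.
pose g := kappa * beta.
have g1 : 1 < g.
  have : kappa * kappa^-1 = 1 by rewrite divff// gt_eqF; lra.
  by rewrite /g betaE /del; nra.
have rk_gt0 k : 0 < r ^+ k by exact: exprn_gt0.
pose k0 := (Num.truncn (2 / l)).+2.
have kl k : (k0 <= k)%N -> 2 <= k%:R * l.
  move=> k0k; rewrite -ler_pdivrMr//; apply: le_trans (_ : k0%:R <= _); last by rewrite ler_nat.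
  by rewrite ltW// /k0; apply: lt_trans (truncnS_gt _) _; rewrite ltr_nat.
(* [L k] is [ln (ln (r ^ k))], so [p k] lies below [a_seq alpha n] throughout the block
   [r^k < n <= r^(k+1)], and [m k] is the first integer of that block or beyond. The choice of [k0]
   gives [L k >= ln 2], hence [q k <= 1/2] below. *)
pose L k := ln (k%:R * l).
pose p k := alpha * L k / r ^+ k.+1.
pose m k := (Num.truncn (r ^+ k)).+1.
have L0 k : (k0 <= k)%N -> 0 < L k.
  by move=> /kl kl2; apply: ln_gt0; lra.
have p0 k : (k0 <= k)%N -> 0 < p k.
  by move=> /L0 Lk; rewrite /p divr_gt0// mulr_gt0//; lra.
have mr k : r ^+ k < (m k)%:R by exact: truncnS_gt.
have mp k : (k0 <= k)%N -> kappa * L k <= (m k)%:R * p k.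
  move=> kk; apply: (@le_trans _ _ (r ^+ k * p k)).
    rewrite /p /kappa exprS le_eqVlt; apply/orP; left; apply/eqP.
    by field; rewrite !gt_eqF.
  by rewrite ler_wpM2r ?(ltW (p0 _ _))// ltW.
pose q k := expR (- (g * L k)).
have q_half k : (k0 <= k)%N -> q k <= 2^-1.
  move=> kk; have l2 : ln 2 <= L k.
    by rewrite /L ler_ln ?posrE//; have := kl k kk; lra.
  have -> : 2^-1 = expR (- ln 2) :> R by rewrite expRN lnK ?posrE.
  by rewrite /q ler_expR; have := L0 k kk; nra.
have yE kj : exists y, 0 < p kj.1 -> 2 ^+ kj.2 * p kj.1 <= 1 -> 1 - F y = 2 ^+ kj.2 * p kj.1.
  have [[pk p1]|npk] := pselect (0 < p kj.1 /\ 2 ^+ kj.2 * p kj.1 <= 1).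
    have p20 : 0 < 2 ^+ kj.2 * p kj.1 by rewrite mulr_gt0// exprn_gt0.
    have [||y _ Fy] := F_quantile (1 - 2 ^+ kj.2 * p kj.1); [lra|lra|].
    by exists y => _ _; rewrite Fy; ring.
  by exists 0 => ? ?; exfalso; apply: npk.
have {yE} /choice[y yE] := yE.
(* Values [2 ^+ j * p k] above 1 are not survival probabilities; the empty event there lets [j]
   range over all naturals. *)
pose D i j : set T := if 2 ^+ j * p (i + k0)%N <= 1 then
  [set w | (N (m (i + k0)%N) (y ((i + k0)%N, j)) w)%:R <=
    c * ((m (i + k0)%N)%:R * (1 - F (y ((i + k0)%N, j))))] else set0.
pose u i j : R := q (i + k0)%N * 2^-1 ^+ j.
have u0 i j : 0 <= u i j by rewrite /u mulr_ge0 ?expR_ge0.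
have mD i j : measurable (D i j).
  rewrite /D; case: ifP => // _.
  exact: (measurable_exceedances X mX _ _ [set n | n%:R <= c * _]).
have beta0 : 0 < beta by rewrite betaE; lra.
have PD i j : (P (D i j) <= (u i j)%:E)%E.
  rewrite /D; case: ifPn => [p1|_]; last by rewrite measure0 lee_fin.
  set k := (i + k0)%N in p1 *; have kk : (k0 <= k)%N by rewrite leq_addl.
  apply: le_trans (exceedances_lower_tail _ s c beta _ (ltW s0) erefl) _.
  rewrite yE//=; last exact: p0.
  (* The exponent grows like [2^j * g * L k >= (j + 1) * g * L k]. One factor [q k] is kept for the
     sum over blocks, and the other [j] are at most [1/2], giving a geometric series over the
     grid. *)
  rewrite lee_fin; apply: (@le_trans _ _ (q k ^+ j.+1)).
    rewrite /q -expRM_natl ler_expR mulrN lerN2.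
    have j2 : j.+1%:R <= 2 ^+ j :> R by rewrite -natrX ler_nat ltn_expl.
    apply: (@le_trans _ _ (2 ^+ j * (g * L k))).
      by rewrite ler_wpM2r// mulr_ge0 ?(ltW (L0 _ kk))//; lra.
    rewrite (_ : beta * _ = 2 ^+ j * (beta * ((m k)%:R * p k))); last by ring.
    rewrite ler_wpM2l ?exprn_ge0// /g [kappa * _]mulrC -mulrA ler_wpM2l ?(ltW beta0)//.
    exact: mp.
  rewrite exprS /u ler_wpM2l ?expR_ge0// lerXn2r ?nnegrE ?expR_ge0//.
  exact: q_half.
have sumu K J : \sum_(i < K) \sum_(j < J) u i j <= 2 * (expR (- (g * ln l)) * (g - 1)^-1).
  apply: (@le_trans _ _ (\sum_(i < K) 2 * (expR (- (g * ln l)) * expR (- (g * ln i.+2%:R))))).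
    apply: ler_sum => i _; rewrite -mulr_sumr.
    apply: (@le_trans _ _ (q (i + k0)%N * 2)).
      rewrite ler_wpM2l ?expR_ge0//.
      apply: le_trans (sum_geometric_le R 2^-1 J _ _) _; rewrite ?invr_ge0// ?invf_lt1 ?ltr1n//.
      by rewrite (_ : (1 - 2^-1)^-1 = 2 :> R)//; field.
    rewrite mulrC ler_wpM2l// /q -expRD ler_expR /L lnM ?posrE ?ltr0n ?addnS//.
    rewrite -mulrN -!mulrN -mulrDr; apply: ler_wpM2l; first lra.
    suff : ln i.+2%:R <= ln (i + k0)%N%:R :> R by rewrite /k0 !addnS; lra.
    by rewrite ler_ln ?posrE ?ltr0n /k0 ?addnS// ler_nat !ltnS leq_addr.
  rewrite -mulr_sumr -mulr_sumr ler_wpM2l// ler_wpM2l ?expR_ge0//.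
  exact: sum_expR_ln_le.
(* The factor [r] is lost in passing from [n] down to [m k > r^k >= n / r], and the factor 2 in
   passing from [1 - F x] to the grid value just below it. *)
exists (c / (2 * r)); first by rewrite divr_gt0// mulr_gt0.
have := ae_eventually_none_family P D u _ mD PD sumu.
apply: filterS => w [K _ HK].
pose n0 := m (K + k0)%N.
exists n0 => // n /= n0n x Sx.
have rn : r ^+ (K + k0)%N < n%:R by apply: lt_le_trans (mr _) _; rewrite ler_nat.
have exk : exists i, n%:R <= r ^+ i.
  exists (Num.truncn (n%:R / l)).+1.
  rewrite -[r](lnK (x := r)) ?posrE// -expRM_natl.
  apply: le_trans (expR_ge1Dx _).
  have := truncnS_gt (n%:R / l); rewrite ltr_pdivrMr// -/l; lra.
have [[|k] nrk kmin] := ex_minnP exk.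
  have : 1 <= r ^+ (K + k0) by rewrite exprn_ege1// ltW.
  by move: nrk; rewrite expr0 => nrk r1k; lra.
have rkn : r ^+ k < n%:R.
  by rewrite ltNge; apply/negP => /kmin; rewrite ltnn.
have Kk : (K + k0 <= k)%N.
  rewrite -ltnS -(ltr_eXn2l (x := r))//; exact: lt_le_trans rn nrk.
have kk : (k0 <= k)%N by apply: leq_trans Kk; rewrite leq_addl.
have n_gt0 : 0 < n%:R :> R by apply: lt_trans rkn.
have pS : p k < 1 - F x.
  apply: lt_le_trans Sx; rewrite /p /a_seq.
  have lnn : k%:R * l < ln n%:R.
    by rewrite mulr_natl -lnXn// ltr_ln// posrE.
  have LL : L k < ln (ln n%:R).
    by rewrite /L ltr_ln// posrE; have := kl k kk; lra.
  have := L0 k kk => Lk.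
  rewrite -2!mulrA ltr_pM2l; last lra.
  apply: (@le_lt_trans _ _ (L k / n%:R)); last by rewrite ltr_pM2r// invr_gt0.
  by rewrite ler_pM2l// lef_pV2 ?posrE.
have pk := p0 k kk.
have exj : exists j, 1 - F x <= 2 ^+ j * p k.
  exists (Num.truncn (p k)^-1).+1.
  apply: (@le_trans _ _ 1); first by have := F_ge0 x; lra.
  rewrite -ler_pdivrMr// div1r ltW//; apply: lt_le_trans (truncnS_gt _) _.
  by rewrite -natrX ler_nat ltnW// ltn_expl.
have [[|j] Sj jmin] := ex_minnP exj.
  by move: Sj; rewrite expr0 mul1r => Sj; lra.
have jS : 2 ^+ j * p k < 1 - F x.
  by rewrite ltNge; apply/negP => /jmin; rewrite ltnn.
have j1 : 2 ^+ j * p k <= 1 by have := F_ge0 x; lra.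
have Fy := yE (k, j) pk j1; rewrite /= in Fy.
have xy : x <= y (k, j).
  by rewrite leNgt; apply/negP => /ltW/F_nd; lra.
have := HK (k - k0)%N; rewrite /= leq_subRL// addnC => /(_ Kk j).
rewrite /D subnK// j1 Fy => /negP; rewrite -ltNge => /ltW NL.
have mn : (m k <= n)%N.
  rewrite /m -(ltr_nat R); apply: le_lt_trans rkn.
  by have /andP[] := truncn_itv (ltW (rk_gt0 k)).
apply: (@le_trans _ _ (N (m k) (y (k, j)) w)%:R); last first.
  rewrite ler_nat; apply: leq_trans (exceedances_nonincreasing X _ _ _ w xy) _.
  exact: leq_exceedances.
apply: le_trans NL; rewrite (_ : c / (2 * r) * _ = c * (n%:R / r * ((1 - F x) / 2))); last first.
  by field; rewrite gt_eqF.
rewrite ler_wpM2l ?(ltW c0)//; apply: ler_pM.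
- by rewrite divr_ge0// ltW.
- by rewrite divr_ge0//; lra.
- apply: le_trans (ltW (mr k)).
  by rewrite ler_pdivrMr// mulrC -exprS.
- by rewrite ler_pdivrMr// mulrC mulrA -exprS.
Qed.

End survival_ratio.

(** * Deterministic bounds for the mean residual life *)

(** In the application [u] is an empirical survival function. The bound by [eps * g] makes [u - v]
    integrable, and [v = u - (u - v)] inherits integrability. *)
Lemma Rintegral_dist_le d (T : measurableType d) (R : realType)
    (mu : {measure set T -> \bar R}) (D : set T) (u v g : T -> R) (eps K : R) :
  measurable D -> mu.-integrable D (EFin \o u) -> measurable_fun D v ->
  measurable_fun D g -> (forall t, D t -> 0 <= g t) -> 0 <= eps ->
  (forall t, D t -> `|u t - v t| <= eps * g t) ->
  (\int[mu]_(t in D) (g t)%:E <= K%:E)%E ->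
  `|\int[mu]_(t in D) u t - \int[mu]_(t in D) v t| <= eps * K.
Proof.
move=> mD iu mv mg g0 eps0 uvg gK.
have ig : mu.-integrable D (EFin \o g).
  apply/integrableP; split; first exact/measurable_EFinP.
  apply: le_lt_trans (ltry K); apply: le_trans gK; rewrite le_eqVlt; apply/orP; left.
  by apply/eqP/eq_integral => t; rewrite inE => Dt /=; rewrite ger0_norm// g0.
have ieg : mu.-integrable D (EFin \o (fun t => eps * g t)).
  rewrite (_ : EFin \o _ = (fun t => eps%:E * (EFin \o g) t)%E); first exact: integrableZl.
  by apply/funext => t /=; rewrite EFinM.
have iuv : mu.-integrable D (EFin \o (fun t => u t - v t)).
  apply: le_integrable ieg => //.
    apply/measurable_EFinP/measurable_funB => //; apply/measurable_EFinP.
    by case/integrableP: iu.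
  by move=> t Dt /=; rewrite lee_fin (le_trans (uvg t Dt))// ler_norm.
have iv : mu.-integrable D (EFin \o v).
  rewrite (_ : EFin \o v = (fun t => (EFin \o u) t - (EFin \o (fun t => u t - v t)%R) t)%E).
    exact: integrableB.
  by apply/funext => t /=; rewrite -EFinB; congr EFin; ring.
rewrite -RintegralB//; apply: le_trans (le_normr_Rintegral mD iuv) _.
apply: (@le_trans _ _ (\int[mu]_(t in D) (eps * g t))).
  apply: le_Rintegral => //; exact: (integrable_abse iuv).
rewrite RintegralZl// ler_wpM2l// -lee_fin fineK//.
exact: integrable_fin_num.
Qed.

(** From [ln (ln n) < ln n < 2 sqrt n] the value is below [2 alpha / sqrt n]. It makes the quantile
    level [1 - a_n] positive. *)
Lemma a_seq_lt1 (R : realType) (alpha : R) : 0 < alpha ->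
  \forall n \near \oo, a_seq alpha n < 1.
Proof.
move=> alpha0.
exists (Num.truncn ((2 * alpha + 1) ^+ 2)).+1 => // n /= n_gt.
have n1 : (2 * alpha + 1) ^+ 2 < n%:R :> R.
  by apply: lt_le_trans (truncnS_gt _) _; rewrite ler_nat.
pose r : R := Num.sqrt n%:R.
have rr : r ^+ 2 = n%:R by rewrite sqr_sqrtr.
have r1 : 2 * alpha + 1 < r.
  by rewrite -(ltr_pXn2r (n := 2))// ?nnegrE ?sqrtr_ge0// ?rr//; lra.
have n0 : 0 < n%:R :> R by rewrite -rr; nra.
have lnr : ln n%:R < 2 * r.
  have r0 : 0 < r by lra.
  by have := ln_sublinear r0; rewrite -rr lnXn// -mulr_natl; lra.
have ln_gt : 0 < ln (n%:R : R) by apply: (@ln_gt0 R); rewrite -rr; nra.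
have lln := ln_sublinear ln_gt.
rewrite /a_seq ltr_pdivrMr// mul1r.
apply: (@lt_trans _ _ (alpha * (2 * r))); last by rewrite -rr; nra.
by rewrite ltr_pM2l//; lra.
Qed.

(** Positivity of [u] keeps the set defining the quantile inside [[0, oo[], so its infimum is
    genuine. Were [u < F x], continuity would put a point to the left of [x] into that set. *)
Lemma le_quantile (R : realType) (F : R -> R) (u x : R) : continuous F ->
  (forall y, y < 0 -> F y = 0) -> 0 < u -> x <= quantile F u -> F x <= u.
Proof.
move=> contF F_neg u0 xq; rewrite leNgt; apply/negP => uFx.
have lbF : has_lbound [set y | u <= F y].
  by exists 0 => y /= uy; rewrite leNgt; apply/negP => /F_neg Fy0; lra.
have [e /= e0 He] : \forall y \near x, u < F y by exact: (cvgr_gt _ (contF x)).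
have : u < F (x - e / 2).
  apply: He; rewrite /= opprB addrC subrK ger0_norm; lra.
move=> /ltW/(ge_inf lbF); rewrite -/(quantile F u); lra.
Qed.

Section mean_residual_life.
Context {R : realType} {d : measure_display} {T : measurableType d}.
Variables (X : nat -> T -> R) (F h : R -> R).
Hypothesis F_nd : forall x y : R, x <= y -> F x <= F y.
Hypothesis F_ge0 : forall x, 0 <= F x.
Hypothesis F_le1 : forall x, F x <= 1.
Hypothesis hH : H_down h.
Local Notation N := (exceedances X).
Local Notation mu := (@lebesgue_measure R).

Lemma one_minus_empF n w t : (0 < n)%N ->
  1 - empF X n w t = (N n t w)%:R / n%:R.
Proof.
move=> n0; have nz : n%:R != 0 :> R by rewrite pnatr_eq0 -lt0n.
have : (#|[set i : 'I_n | (X i w <= t)%R]| + N n t w = n)%N.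
  rewrite -sum1_card /exceedances big_mkcond -big_split/=.
  rewrite -[RHS]card_ord -sum1_card; apply: eq_bigr => i _.
  rewrite (_ : (i \in _) = (X i w <= t)); first by case: leP.
  by apply/idP/idP => [/set_mem|/mem_set].
move=> /(congr1 (fun k => k%:R : R)); rewrite natrD => cardE.
by rewrite /empF -[X in X - _](divff nz) -mulrBl -[X in X - _]cardE addrAC subrr add0r.
Qed.

Lemma ehatE n w x : (0 < n)%N -> 0 <= x -> (0 < N n x w)%N ->
  ehat X n w x = \int[mu]_(t in `[x, +oo[) (1 - empF X n w t) / (1 - empF X n w x).
Proof.
move=> n0 x0 Nx; rewrite /ehat x0/=; case: ifPn => //.
rewrite negb_exists => /forallP noX; move: Nx.
by rewrite /exceedances big1// => i _; apply/eqP; rewrite eqb0 noX.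
Qed.

Lemma integrable_exceedances n w x :
  mu.-integrable `[x, +oo[ (fun t => (N n t w)%:R%:E).
Proof.
elim: n => [|n ih].
  rewrite (_ : (fun _ => _) = cst 0%E); first exact: integrable0.
  by apply/funext => t; rewrite /exceedances big_ord0.
rewrite (_ : (fun _ => _) =
    ((fun t => (N n t w)%:R%:E) \+ (fun t => ((t < X n w)%R%:R)%:E))%E); last first.
  by apply/funext => t /=; rewrite exceedancesS natrD.
apply: integrableD => //.
have : mu.-integrable `[x, +oo[ (EFin \o \1_(`[x, X n w]%classic)).
  by apply: integrableS (integrable_indic_itv x (X n w) true false).
apply: le_integrable => //.
  apply/measurable_EFinP; apply: nonincreasing_measurable => // s t st.
  rewrite ler_nat; case: ltP => // tX; by rewrite (le_lt_trans st tX).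
move=> t /=; rewrite in_itv/= andbT => xt; rewrite lee_fin.
rewrite indicE; case: ltP => [tX|_]; last by rewrite normr0.
by rewrite mem_set//= in_itv/= xt ltW.
Qed.

Lemma mrl_ge0 x : 0 <= mrl F x.
Proof.
rewrite /mrl divr_ge0 ?subr_ge0//; apply: fine_ge0; apply: integral_ge0 => t _.
by rewrite lee_fin subr_ge0.
Qed.

Lemma h_F_ge0 x : 0 <= h (F x).
Proof. by apply: hH.1; rewrite F_ge0 F_le1. Qed.

Lemma measurable_h_F (D : set R) : measurable D -> measurable_fun D (h \o F).
Proof.
by move=> mD; apply: nonincreasing_measurable => // s t st; apply: hH.2.1 => //; exact: F_nd.
Qed.

(** The two almost sure facts enter here as hypotheses at one sample point. The bound [K] on the
    tail integral stays free, because the two parts of the theorem bound that integral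
    differently. *)
Lemma ehat_error_le n w x (c eps K : R) : (0 < n)%N -> 0 <= x -> 0 < c -> 0 < eps ->
  0 < 1 - F x -> c * (n%:R * (1 - F x)) <= (N n x w)%:R ->
  (forall t, 0 <= t ->
    `|(N n t w)%:R - n%:R * (1 - F t)| <= n%:R * (eps * h (F t))) ->
  (\int[mu]_(t in `[x, +oo[) (h (F t))%:E <= K%:E)%E ->
  `|ehat X n w x - mrl F x| * (1 - F x) <= eps / c * (K + mrl F x * h (F x)).
Proof.
move=> n0 x0 c0 eps0 S0 cS dev hK.
have n_gt0 : 0 < n%:R :> R by rewrite ltr0n.
have devS t : 0 <= t -> `|(1 - empF X n w t) - (1 - F t)| <= eps * h (F t).
  move=> t0; rewrite one_minus_empF// -(ler_pM2l n_gt0); apply: le_trans (dev t t0).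
  rewrite -[X in X * _ <= _]ger0_norm// -normrM mulrBr mulrCA divff ?mulr1//.
  by rewrite gt_eqF.
have Sn : c * (1 - F x) <= 1 - empF X n w x.
  by rewrite one_minus_empF// ler_pdivlMr// -mulrA [_ * n%:R]mulrC.
have cS0 : 0 < c * (1 - F x) by exact: mulr_gt0.
have Nx0 : (0 < N n x w)%N.
  rewrite -(ltr_nat R); apply: lt_le_trans cS.
  by rewrite !mulr_gt0.
have intS : `|\int[mu]_(t in `[x, +oo[) (1 - empF X n w t) -
    \int[mu]_(t in `[x, +oo[) (1 - F t)| <= eps * K.
  apply: (@Rintegral_dist_le _ _ _ mu _ _ _ (h \o F)) => //.
  - rewrite (_ : EFin \o _ = (fun t => n%:R^-1%:E * (N n t w)%:R%:E)%E).
      by apply: integrableZl => //; exact: integrable_exceedances.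
    by apply/funext => t /=; rewrite one_minus_empF// -EFinM mulrC.
  - by apply: nonincreasing_measurable => // s t st; rewrite lerB// F_nd.
  - exact: measurable_h_F.
  - by move=> t _; exact: h_F_ge0.
  - exact: ltW.
  - by move=> t /=; rewrite in_itv/= andbT => xt; apply: devS; lra.
have := devS x x0.
rewrite ehatE// -[mrl F x]/(\int[mu]_(t in `[x, +oo[) (1 - F t) / (1 - F x)).
set I := Rintegral _ _ _ in intS *; set J := Rintegral _ _ _ in intS *.
set s := 1 - F x in S0 Sn cS0 *; set sn := 1 - empF X n w x in Sn *.
have sn0 : 0 < sn by apply: lt_le_trans Sn.
move=> dS.
have e0 : 0 <= J / s.
  by have := mrl_ge0 x.
have -> : I / sn - J / s = ((I - J) + J / s * (s - sn)) / sn.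
  by field; rewrite !gt_eqF.
rewrite normrM normfV (gtr0_norm sn0) -[leLHS]mulrA.
apply: (@le_trans _ _ ((eps * K + J / s * (eps * h (F x))) * c^-1)).
  apply: ler_pM => //.
  - by rewrite mulr_ge0 ?invr_ge0// ltW.
  - apply: le_trans (ler_normD _ _) _; apply: lerD => //.
    by rewrite normrM (ger0_norm e0) ler_wpM2l// distrC.
  - by rewrite ler_pdivrMl// ler_pdivlMr// mulrC.
by rewrite le_eqVlt; apply/orP; left; apply/eqP; ring.
Qed.

End mean_residual_life.

(** * Both convergence statements from one weighted bound *)

Theorem theorem2p1 (R : realType) (d : measure_display) (T : measurableType d)
  (P : probability T R) (X : nat -> T -> R) (F f : R -> R) (alpha : R) :
  (forall i, measurable_fun setT (X i)) ->
  mutually_independent P X ->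
  (forall i, has_cdf P (X i) F) ->
  continuous F ->
  (forall x, x < 0 -> F x = 0) ->
  measurable_fun setT f ->
  (forall x, 0 <= x -> (F x)%:E = (\int[lebesgue_measure]_(t in `[0%R, x]) (f t)%:E)%E) ->
  (forall x, 0 <= x -> 0 < f x) ->
  P.-integrable setT (EFin \o X 0%N) ->
  1 < alpha ->
  (* (i) *)
  (forall h : R -> R, H_down h ->
    (exists M : R, forall x, 0 <= x ->
      (\int[lebesgue_measure]_(t in `[x, +oo[) (h (F t))%:E <=
        (M * (h (F x) * mrl F x))%:E)%E) ->
    {ae P, forall w, forall eps : R, 0 < eps ->
      \forall n \near \oo, forall x, 0 <= x <= b_seq F alpha n ->
        `|ehat X n w x - mrl F x| * (1 - F x) / (h (F x) * mrl F x) <= eps})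
  /\
  (* (ii) *)
  (forall h : R -> R, H_down h ->
    (\int[lebesgue_measure]_(t in `[0%R, +oo[) (h (F t))%:E < +oo)%E ->
    (exists M : R, forall x, 0 <= x -> mrl F x * h (F x) <= M) ->
    {ae P, forall w, forall eps : R, 0 < eps ->
      \forall n \near \oo, forall x, 0 <= x <= b_seq F alpha n ->
        `|ehat X n w x - mrl F x| * (1 - F x) <= eps}).
Proof.
move=> mX indX cdfX contF F_neg mf densF f_gt0 _ alpha1.
have F_nd := has_cdf_nondecreasing P (X 0%N) F (mX 0%N) (cdfX 0%N).
have F_ge0 := has_cdf_ge0 P (X 0%N) F (cdfX 0%N).
have F_le1 := has_cdf_le1 P (X 0%N) F (mX 0%N) (cdfX 0%N).
have survX x i := has_cdf_survival P (X i) F (mX i) (cdfX i) x.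
have F_incr := cdf_density_increasing P (X 0%N) F f (mX 0%N) (cdfX 0%N) mf densF f_gt0.
have F_lt1 := cdf_density_lt1 P (X 0%N) F f (mX 0%N) (cdfX 0%N) mf densF f_gt0.
have F_quantile := cdf_density_quantile P (X 0%N) F f (mX 0%N) (cdfX 0%N) contF densF.
have [c c0 ratio] :=
  ae_survival_ratio P X F mX indX survX F_ge0 F_nd F_quantile alpha alpha1.
(* Common form of the two parts: [B] is [h (F x) * mrl F x] in (i) and the constant 1 in (ii), and
   [K] may depend on [x]. *)
have key (h : R -> R) (B : R -> R) (M : R) : H_down h ->
    (forall x, 0 <= x -> 0 <= B x) ->
    (forall x, 0 <= x -> exists K,
      (\int[lebesgue_measure]_(t in `[x, +oo[) (h (F t))%:E <= K%:E)%E /\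
      K + mrl F x * h (F x) <= M * B x) ->
    {ae P, forall w, forall eps : R, 0 < eps ->
      \forall n \near \oo, forall x, 0 <= x <= b_seq F alpha n ->
        `|ehat X n w x - mrl F x| * (1 - F x) <= eps * B x}.
  move=> hH B0 hB.
  have gc := ae_weighted_glivenko_cantelli P X F mX indX survX F_ge0 F_incr F_lt1 F_quantile h hH.
  apply: filterS2 ratio gc => w ratio_w gc_w eps eps0.
  have M0 : 0 < `|M| + 1 by have := normr_ge0 M; lra.
  (* The precision absorbs both the [1 / c] of [ehat_error_le] and [M]; [M] may have any sign, so
     the positive number [|M| + 1] stands in for it. *)
  have e0 : 0 < eps * c / (`|M| + 1) by rewrite divr_gt0// mulr_gt0.
  have a_lt1 : \forall n \near \oo, a_seq alpha n < 1 by apply: a_seq_lt1; lra.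
  have n_gt0 : \forall n \near \oo, (0 < n)%N by exists 1%N.
  near=> n => x /andP[x0 xb].
  have Fxb : F x <= 1 - a_seq alpha n.
    apply: le_quantile contF F_neg _ xb; rewrite subr_gt0.
    by near: n.
  have [K [hK KM]] := hB x x0.
  have S0 : 0 < 1 - F x by have := F_lt1 x x0; lra.
  have cS : c * (n%:R * (1 - F x)) <= (exceedances X n x w)%:R.
    have : a_seq alpha n <= 1 - F x by lra.
    by move: x {x0 xb Fxb hK KM S0}; near: n.
  have n0 : (0 < n)%N by near: n.
  have dev : forall t, 0 <= t -> `|(exceedances X n t w)%:R - n%:R * (1 - F t)| <=
      n%:R * (eps * c / (`|M| + 1) * h (F t)).
    by near: n; exact: gc_w.
  apply: le_trans (ehat_error_le X F h F_nd F_ge0 F_le1 hH n w x c _ K n0 x0 c0 e0 S0 cS dev hK) _.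
  rewrite (_ : eps * c / (`|M| + 1) / c = eps / (`|M| + 1)); last first.
    by field; rewrite !gt_eqF.
  rewrite -mulrA ler_wpM2l ?(ltW eps0)// ler_pdivrMl//.
  apply: le_trans KM _; rewrite ler_wpM2r ?B0//.
  by have := ler_norm M; lra.
split=> h hH.
- move=> [M hM].
  have he0 x : 0 <= h (F x) * mrl F x.
    by rewrite mulr_ge0 ?mrl_ge0// (h_F_ge0 F h).
  have := key h (fun x => h (F x) * mrl F x) (M + 1) hH (fun x _ => he0 x).
  move=> /(_ _)/filterS; apply; last first.
    move=> x x0; exists (M * (h (F x) * mrl F x)); split; first exact: hM.
    by rewrite le_eqVlt; apply/orP; left; apply/eqP; ring.
  move=> w Hw eps eps0; apply: filterS (Hw eps eps0) => n Hn x xb.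
  (* Where the weight vanishes, the quotient is 0 by the convention [0^-1 = 0]. *)
  have := he0 x; rewrite le_eqVlt => /orP[/eqP <-|he].
    by rewrite invr0 mulr0 ltW.
  by rewrite ler_pdivrMr// Hn.
- move=> hI [M hM].
  pose K := fine (\int[lebesgue_measure]_(t in `[0%R, +oo[) (h (F t))%:E)%E.
  have := key h (fun=> 1) (K + M) hH (fun=> fun=> ler01).
  move=> /(_ _)/filterS; apply; last first.
    move=> x x0; exists K; split; last first.
      by rewrite mulr1 lerD2l; exact: hM.
    have h0 t : (0 <= (h (F t))%:E)%E by rewrite lee_fin (h_F_ge0 F h).
    rewrite /K fineK; last by rewrite ge0_fin_numE// integral_ge0.
    apply: ge0_subset_integral => //.
      by apply/measurable_EFinP; exact: measurable_h_F.
    by move=> t /=; rewrite !in_itv/= !andbT; exact: le_trans.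
  by move=> w Hw eps eps0; apply: filterS (Hw eps eps0) => n Hn x xb; rewrite -[eps]mulr1 Hn.
Unshelve. all: by end_near. Qed.
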